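(* Let $N\ge 1$, $w\in\mathbb{R}^N$, $\mathcal{C}:=\{i: w_i\neq 0\}$, let $\mathcal{F}\subseteq\{0,1\}^{\mathcal{C}}$ be the (projected) feasible set of core assignments of a combinatorial problem, and let $$V(z)=\sum_{1\le i\le j\le N}Q_{ij}z_iz_j+\sum_{i=1}^N d_iz_i+\mathrm{const}$$ be a quadratic penalty satisfying: (C1) $V$ is diagonal-free on the core variables: $Q_{ii}=0$ for all $i\in\mathcal{C}$; (C2) the coefficients of $V$ are integers: $Q_{ij},d_i\in\mathbb{Z}$; (C3) $V$ is locally repairable with some margin $\delta>0$ relative to some bounded set of directions $\mathcal{D}\subseteq\mathbb{R}^N$. Then there exists a finite threshold $\gamma^\star>0$ such that for all $\gamma>\gamma^\star$, every local minimizer of $\hat f(z)=w^\top z+\gamma V(z)$ over the box $[0,1]^N$ has a binary core belonging to $\mathcal{F}$.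
   Context: The core of $z\in[0,1]^N$ is the restriction $z_{\mathcal{C}}=(z_i)_{i\in\mathcal{C}}$; it is binary if $z_{\mathcal{C}}\in\{0,1\}^{\mathcal{C}}$. The tangent cone of the box at $z\in[0,1]^N$ is $T(z):=\{d\in\mathbb{R}^N : z_i=0\Rightarrow d_i\ge 0,\ z_i=1\Rightarrow d_i\le 0\}$ (coordinates with $0<z_i<1$ are unrestricted). $V$ is locally repairable with margin $\delta>0$ relative to $\mathcal{D}$ if for every $z\in[0,1]^N$ with $z_{\mathcal{C}}\in\{0,1\}^{\mathcal{C}}\setminus\mathcal{F}$ there exists $d\in\mathcal{D}\cap T(z)$ with $\langle\nabla V(z),d\rangle\le-\delta$. A local minimizer of $\hat f$ over $[0,1]^N$ is a point of $[0,1]^N$ minimizing $\hat f$ among all points of $[0,1]^N$ in some neighborhood of it. *)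

(* Defs.v *)
From mathcomp Require Import all_boot all_order all_algebra.
From mathcomp Require Import all_classical all_reals all_analysis.

Set Implicit Arguments.
Unset Strict Implicit.
Unset Printing Implicit Defensive.

Import Order.TTheory GRing.Theory Num.Theory.
Import numFieldNormedType.Exports.

Local Open Scope classical_set_scope.
Local Open Scope ring_scope.

Notation core_idx w := {i : 'I__ | w 0%R i != 0%R}.

Section Defs.
Context {R : realType} {N : nat}.
Implicit Types (w z d : 'rV[R]_N) (V f : 'rV[R]_N -> R).

Definition dot (u v : 'rV[R]_N) : R := \sum_(i < N) u 0 i * v 0 i.

Definition grad V z : 'rV[R]_N := \row_(i < N) 'D_(delta_mx 0 i) V z.

Definition box : set 'rV[R]_N := [set z | forall i, 0 <= z 0 i <= 1].

Definition tangent_cone z : set 'rV[R]_N :=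
  [set d | forall i, (z 0 i = 0 -> 0 <= d 0 i) /\ (z 0 i = 1 -> d 0 i <= 0)].

Definition core w z : {ffun core_idx w -> R} := [ffun i => z 0 (val i)].

(* {0,1}^C as a subset of R^C, so that real-valued cores can be compared with
   binary assignments directly. *)
Definition binary_core w : set {ffun core_idx w -> R} :=
  [set x : {ffun core_idx w -> R} | forall i, x i = 0 \/ x i = 1].

(* Only the entries Q i j with i <= j are used. *)
Definition quadratic (Q : 'M[R]_N) (b : 'rV[R]_N) (c : R) z : R :=
  \sum_(i < N) \sum_(j < N | (i <= j)%N) Q i j * z 0 i * z 0 j
  + \sum_(i < N) b 0 i * z 0 i + c.

Definition locally_repairable w (F : set {ffun core_idx w -> R}) V
    (delta : R) (D : set 'rV[R]_N) : Prop :=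
  0 < delta /\
  forall z, box z -> (@binary_core w `\` F) (core w z) ->
    exists d, (D `&` tangent_cone z) d /\ dot (grad V z) d <= - delta.

Definition local_minimizer_on_box f z : Prop :=
  box z /\ \forall y \near z, box y -> f z <= f y.

End Defs.

(* Main.v *)
(* Along a direction d, V(z + t d) = V(z) + t <grad V(z), d> + t^2 q(d).  If a
   core variable i is fractional at a local minimizer, then for every other
   fractional j the form q must be nonnegative on span(e_i, e_j); since its
   (i, i) coefficient vanishes, so does its (i, j) cross coefficient.  Hence only
   binary variables enter d_i V(z), which is an integer, and the stationarity
   w_i + gamma d_i V(z) = 0 fails for gamma > |w_i|.  If the core is binary but
   infeasible, the repair direction is a descent direction as soon as gamma delta
   exceeds the variation of w along the bounded set of directions. *)

Require Import Defs.
From mathcomp Require Import all_boot all_order all_algebra.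
From mathcomp Require Import all_classical all_reals all_analysis.
From mathcomp Require Import ring lra.

Set Implicit Arguments.
Unset Strict Implicit.
Unset Printing Implicit Defensive.

Import Order.TTheory GRing.Theory Num.Theory.
Import numFieldNormedType.Exports.

Local Open Scope classical_set_scope.
Local Open Scope ring_scope.

Lemma affine_cvg0 (R : realType) (V : normedModType R) (a b : V) :
  (a + t *: b) @[t --> (0 : R)] --> a.
Proof.
have : (a + t *: b) @[t --> (0 : R)] --> a + 0 *: b.
  apply: cvgD; first exact: cvg_cst.
  by apply: cvgZ; [exact: cvg_id|exact: cvg_cst].
by rewrite scale0r addr0.
Qed.

(** * Bilinear forms, the expansion of a quadratic along a line, and its gradient *)

Section QuadraticForms.
Context {R : realType} {N : nat}.
Implicit Types (x y z d u v : 'rV[R]_N) (Q U : 'M[R]_N).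

(** Zeroing the entries below the diagonal turns the sum over [i <= j] into a full matrix product.
    The result is not symmetric, which is why gradients below involve [upper Q + (upper Q)^T]. *)
Definition upper Q : 'M[R]_N :=
  \matrix_(i, j) if (i <= j)%N then Q i j else 0.

Definition bform U x y : R := (x *m U *m y^T) 0 0.

Lemma bformE U x y :
  bform U x y = \sum_i \sum_j U i j * x 0 i * y 0 j.
Proof.
rewrite /bform mxE exchange_big /=; apply: eq_bigr => j _.
rewrite !mxE mulr_suml; apply: eq_bigr => i _.
by rewrite [U i j * _]mulrC.
Qed.

Lemma dotE u v : dot u v = (u *m v^T) 0 0.
Proof. by rewrite mxE; apply: eq_bigr => i _; rewrite mxE. Qed.

Lemma dotDr u v d : dot u (v + d) = dot u v + dot u d.
Proof. by rewrite !dotE linearD mulmxDr mxE. Qed.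

Lemma dotDl u v d : dot (u + v) d = dot u d + dot v d.
Proof. by rewrite !dotE mulmxDl mxE. Qed.

Lemma dotZr u (t : R) d : dot u (t *: d) = t * dot u d.
Proof. by rewrite !dotE linearZ -scalemxAr mxE. Qed.

Lemma dot_delta u (i : 'I_N) : dot u (delta_mx 0 i) = u 0 i.
Proof.
rewrite /dot (bigD1 i) //= big1 => [|j /negPf ji].
  by rewrite mxE !eqxx mulr1 addr0.
by rewrite mxE ji andbF mulr0.
Qed.

Lemma quadraticE Q b c z : quadratic Q b c z = bform (upper Q) z z + dot b z + c.
Proof.
rewrite /quadratic bformE; congr (_ + _ + _).
apply: eq_bigr => i _; rewrite big_mkcond; apply: eq_bigr => j _ /=.
by rewrite mxE; case: ifP => // _; rewrite !mul0r.
Qed.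

Lemma bformC U x y : bform U x y = bform U^T y x.
Proof.
by rewrite /bform -[in LHS](trmxK (x *m U *m _)) [LHS]mxE !trmx_mul trmxK mulmxA.
Qed.

Lemma bformDl U x y z : bform U (x + y) z = bform U x z + bform U y z.
Proof. by rewrite /bform !mulmxDl mxE. Qed.

Lemma bformDr U x y z : bform U x (y + z) = bform U x y + bform U x z.
Proof. by rewrite /bform linearD mulmxDr mxE. Qed.

Lemma bformZl U t x y : bform U (t *: x) y = t * bform U x y.
Proof. by rewrite /bform -!scalemxAl mxE. Qed.

Lemma bformZr U t x y : bform U x (t *: y) = t * bform U x y.
Proof. by rewrite /bform linearZ -scalemxAr mxE. Qed.

Lemma bform_delta U (i j : 'I_N) :
  bform U (delta_mx 0 i) (delta_mx 0 j) = U i j.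
Proof.
have -> : bform U (delta_mx 0 i) (delta_mx 0 j) = dot (row i U) (delta_mx 0 j).
  by rewrite dotE rowE.
by rewrite dot_delta mxE.
Qed.

Definition quadratic_grad Q b z : 'rV[R]_N :=
  z *m (upper Q + (upper Q)^T) + b.

(** Bilinearity makes the second-order Taylor expansion exact for every [t], so that the gradient
    and the minimality conditions reduce to polynomials in one variable. *)
Lemma quadratic_line Q b c z d (t : R) :
  quadratic Q b c (z + t *: d) =
  quadratic Q b c z + t * dot (quadratic_grad Q b z) d
  + t ^+ 2 * bform (upper Q) d d.
Proof.
have -> : dot (quadratic_grad Q b z) d =
    bform (upper Q) z d + bform (upper Q) d z + dot b d.
  by rewrite dotDl mulmxDr dotDl (bformC _ d) !dotE.
rewrite !quadraticE bformDl !bformDr !bformZl !bformZr dotDr dotZr; ring.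
Qed.

Lemma derive_quadratic Q b c z d :
  'D_d (quadratic Q b c) z = dot (quadratic_grad Q b z) d.
Proof.
rewrite /derive; apply/cvg_lim => //.
set A := dot _ _; pose B := bform (upper Q) d d.
(* By [quadratic_line], the difference quotient equals [A + h * B] for [h != 0]. *)
have : (A + h * B) @[h --> (0 : R)^'] --> A.
  by apply: cvg_within_filter; exact: (@affine_cvg0 R R^o).
apply: cvg_trans; apply: near_eq_cvg; near=> h.
have h0 : h != 0 by near: h; exact: nbhs_dnbhs_neq.
by rewrite /= [h *: d + z]addrC quadratic_line /B -/A /GRing.scale /=; field.
Unshelve. all: by end_near. Qed.

Lemma grad_quadratic Q b c z :
  grad (quadratic Q b c) z = quadratic_grad Q b z.
Proof. by apply/rowP => i; rewrite mxE derive_quadratic dot_delta. Qed.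

Lemma ler_dot_norm1 u d (M : R) : (forall i, `|d 0 i| <= M) ->
  dot u d <= (\sum_i `|u 0 i|) * M.
Proof.
move=> dM; rewrite mulr_suml; apply: ler_sum => i _.
by rewrite (le_trans (ler_norm _)) // normrM ler_wpM2l.
Qed.

End QuadraticForms.

(** * First- and second-order conditions at a local minimizer over the box *)

Section LocalMinimizers.
Context {R : realType} {N : nat}.
Implicit Types (z d : 'rV[R]_N) (f : 'rV[R]_N -> R).

Lemma ray_cvg (a b : R) : (a + t * b) @[t --> 0^'+] --> a.
Proof. by apply: cvg_at_right_filter; exact: (@affine_cvg0 R R^o). Qed.

(** In each coordinate, a tight bound is preserved by the sign of [d 0 i] and a slack one by
    continuity; finitely many coordinates share a common range of [t]. *)
Lemma tangent_ray_box z d : box z -> tangent_cone z d ->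
  \forall t \near 0^'+, box (z + t *: d).
Proof.
move=> bz Td; apply: filter_forall => i; have [d0 d1] := Td i.
have /andP[z0 z1] := bz i.
have lo : \forall t \near 0^'+, 0 <= z 0 i + t * d 0 i.
  have [zi0|zi0] := eqVneq (z 0 i) 0.
    near=> t; rewrite zi0 add0r; apply: mulr_ge0; last exact: d0.
    by near: t; exact: nbhs_right_ge.
  by apply: cvgr_ge; [exact: ray_cvg|rewrite lt_neqAle eq_sym zi0].
have hi : \forall t \near 0^'+, z 0 i + t * d 0 i <= 1.
  have [zi1|zi1] := eqVneq (z 0 i) 1.
    near=> t; rewrite zi1 gerDl; apply: mulr_ge0_le0; last exact: d1.
    by near: t; exact: nbhs_right_ge.
  by apply: cvgr_le; [exact: ray_cvg|rewrite lt_neqAle zi1].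
by near=> t; rewrite !mxE; apply/andP; split; near: t.
Unshelve. all: by end_near. Qed.

(** Dividing [f (z + t *: d) - f z >= 0] by small [t > 0] leaves [0 <= A + t * B]. The limit at 0
    gives the sign of [A]; once [A = 0], a second division gives that of [B]. *)
Lemma local_minimizer_line f z d (A B : R) :
  local_minimizer_on_box f z -> tangent_cone z d ->
  (forall t, f (z + t *: d) = f z + t * A + t ^+ 2 * B) ->
  0 <= A /\ (A <= 0 -> 0 <= B).
Proof.
move=> [bz fmin] Td fE.
have zd : z + t *: d @[t --> 0^'+] --> z.
  by apply: cvg_at_right_filter; exact: affine_cvg0.
have AB : \forall t \near (0 : R)^'+, 0 <= A + t * B.
  have := zd _ fmin; rewrite /= => fmin'.
  near=> t; have t0 : 0 < t by near: t; exact: nbhs_right_gt.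
  have bt : box (z + t *: d) by near: t; exact: tangent_ray_box.
  have : f z <= f (z + t *: d) by move: bt; near: t; exact: fmin'.
  by rewrite fE -addrA lerDl expr2 -mulrA -mulrDr pmulr_rge0.
have A0 : 0 <= A by apply: cvgr_to_ge AB; exact: ray_cvg.
split=> // A0'; have {A0'} A0 : A = 0 by apply/le_anti/andP.
near (0 : R)^'+ => t.
have t0 : 0 < t by near: t; exact: nbhs_right_gt.
have : 0 <= A + t * B by near: t; exact: AB.
by rewrite A0 add0r pmulr_rge0.
Unshelve. all: by end_near. Qed.

(** A direction supported on fractional coordinates is tangent together with its opposite, so the
    one-sided condition applies to both. *)
Lemma local_minimizer_line0 f z d (A B : R) :
  local_minimizer_on_box f z -> (forall i, d 0 i != 0 -> 0 < z 0 i < 1) ->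
  (forall t, f (z + t *: d) = f z + t * A + t ^+ 2 * B) ->
  A = 0 /\ 0 <= B.
Proof.
move=> fmin dz fE.
have dzE i : z 0 i = 0 \/ z 0 i = 1 -> d 0 i = 0.
  move=> zi; apply/eqP; apply: contraT => /dz.
  by case: zi => ->; rewrite ltxx ?andbF.
have [A0 AB] : 0 <= A /\ (A <= 0 -> 0 <= B).
  apply: (local_minimizer_line fmin _ fE) => i.
  by split=> zi; rewrite dzE //; [left|right].
have [NA0 _] : 0 <= - A /\ (- A <= 0 -> 0 <= B).
  apply: (@local_minimizer_line f z (- d)) => // [i|t].
    by split=> zi; rewrite mxE dzE ?oppr0 //; [left|right].
  by rewrite scalerN -scaleNr fE; ring.
by rewrite oppr_ge0 in NA0; split; [apply/le_anti/andP|exact: AB].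
Qed.

End LocalMinimizers.

Lemma affine_bounded_below (R : realFieldType) (a k : R) :
  (forall s : R, 0 <= a + s * k) -> k = 0.
Proof.
move=> h; apply/eqP; apply: contraT => k0.
by have := h (- (a + 1) / k); rewrite divfK //; lra.
Qed.

(** * Integrality of the penalty gradient and binary cores *)

Section PenalizedObjective.
Context {R : realType} {N : nat}.
Variables (w b : 'rV[R]_N) (Q : 'M[R]_N) (c gamma : R).
Implicit Types (z d : 'rV[R]_N).

Let f z := dot w z + gamma * quadratic Q b c z.

Lemma penalized_line z d (t : R) :
  f (z + t *: d) = f z + t * (dot w d + gamma * dot (quadratic_grad Q b z) d)
  + t ^+ 2 * (gamma * bform (upper Q) d d).
Proof. by rewrite /f dotDr dotZr quadratic_line; ring. Qed.

Hypothesis gamma_gt0 : 0 < gamma.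

Lemma fractional_coupling z (i j : 'I_N) :
  local_minimizer_on_box f z -> Q i i = 0 ->
  0 < z 0 i < 1 -> 0 < z 0 j < 1 -> (upper Q + (upper Q)^T) j i = 0.
Proof.
move=> fmin Qii zi zj.
(* Since [upper Q i i = 0], the form at [s e_i + e_j] is affine in [s], with the cross coefficient
   as slope. The case [j = i] is covered as well. *)
apply: (@affine_bounded_below _ (upper Q j j)) => s.
pose d : 'rV[R]_N := s *: delta_mx 0 i + delta_mx 0 j.
have dz k : d 0 k != 0 -> 0 < z 0 k < 1.
  rewrite !mxE /=; have [->//|_] := eqVneq k i.
  by have [->//|_] := eqVneq k j; rewrite mulr0 addr0 eqxx.
have [_] := local_minimizer_line0 fmin dz (penalized_line z d).
rewrite pmulr_rge0 // /d bformDl !bformDr !bformZl !bformZr !bform_delta.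
have -> : upper Q i i = 0 by rewrite mxE leqnn.
have -> : (upper Q + (upper Q)^T) j i = upper Q i j + upper Q j i.
  by rewrite mxE addrC [_^T j i]mxE.
by congr (_ <= _); ring.
Qed.

Lemma fractional_gradient_int z (i : 'I_N) :
  (forall i j : 'I_N, (i <= j)%N -> Q i j \is a Num.int) ->
  (forall i : 'I_N, b 0 i \is a Num.int) ->
  local_minimizer_on_box f z -> Q i i = 0 -> 0 < z 0 i < 1 ->
  quadratic_grad Q b z 0 i \is a Num.int.
Proof.
move=> Qint bint fmin Qii zi; have [bz _] := fmin.
have Uint k l : upper Q k l \is a Num.int.
  by rewrite mxE; case: ifP => [/Qint //|_]; rewrite rpred0.
rewrite mxE rpredD // mxE rpred_sum // => j _.
have [zj|] := boolP (0 < z 0 j < 1).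
  by rewrite (fractional_coupling fmin Qii zi zj) mulr0 rpred0.
have /andP[z0 z1] := bz j.
rewrite negb_and -!leNgt => zj.
have zjint : z 0 j \is a Num.int.
  case/orP: zj => zj.
    by rewrite (_ : z 0 j = 0) ?rpred0 //; apply/le_anti/andP.
  by rewrite (_ : z 0 j = 1) ?rpred1 //; apply/le_anti/andP.
by rewrite rpredM // mxE rpredD // mxE.
Qed.

Lemma local_minimizer_core_binary z (i : 'I_N) :
  (forall i j : 'I_N, (i <= j)%N -> Q i j \is a Num.int) ->
  (forall i : 'I_N, b 0 i \is a Num.int) ->
  local_minimizer_on_box f z -> Q i i = 0 -> w 0 i != 0 ->
  `|w 0 i| < gamma -> z 0 i = 0 \/ z 0 i = 1.
Proof.
move=> Qint bint fmin Qii wi wgamma; have [bz _] := fmin.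
have /andP[z0 z1] := bz i.
have [->|zi0] := eqVneq (z 0 i) 0; first by left.
have [->|zi1] := eqVneq (z 0 i) 1; first by right.
have zi : 0 < z 0 i < 1 by rewrite !lt_neqAle z0 z1 eq_sym zi0 zi1.
have /intrP[k gk] := fractional_gradient_int Qint bint fmin Qii zi.
have dz j : (delta_mx 0 i : 'rV[R]_N) 0 j != 0 -> 0 < z 0 j < 1.
  by rewrite mxE /=; have [->//|_] := eqVneq j i; rewrite eqxx.
have [+ _] := local_minimizer_line0 fmin dz (penalized_line z _).
rewrite !dot_delta gk => wE.
have {}wE : w 0 i = - (gamma * k%:~R) by lra.
have k0 : k != 0 by apply: contraNneq wi => k0; rewrite wE k0 mulr0 oppr0.
(* A nonzero integer [k] has absolute value at least 1, so [w 0 i = - (gamma * k)] would force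
   [gamma <= |w 0 i|]. *)
move: wgamma; rewrite wE normrN normrM (gtr0_norm gamma_gt0).
rewrite gtr_pMr // ltNge -intr_norm ler1z.
by rewrite -gtz0_ge1 normr_gt0 k0.
Qed.

End PenalizedObjective.

Theorem theorem2p8 (R : realType) (N : nat) (hN : (1 <= N)%N)
    (w : 'rV[R]_N) (F : set {ffun core_idx w -> R})
    (hF : F `<=` @binary_core R N w)
    (Q : 'M[R]_N) (b : 'rV[R]_N) (c : R)
    (C1 : forall i : 'I_N, w 0 i != 0 -> Q i i = 0)
    (C2 : (forall i j : 'I_N, (i <= j)%N -> Q i j \is a Num.int) /\
          (forall i : 'I_N, b 0 i \is a Num.int))
    (C3 : exists (delta : R) (D : set 'rV[R]_N),
        bounded_set D /\ locally_repairable F (quadratic Q b c) delta D) :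
  exists gammastar : R, 0 < gammastar /\
    forall gamma : R, gammastar < gamma ->
      forall z : 'rV[R]_N,
        local_minimizer_on_box
          (fun y => dot w y + gamma * quadratic Q b c y) z ->
        binary_core (core w z) /\ F (core w z).
Proof.
have [Qint bint] := C2; have [delta [D [bD [delta0 repair]]]] := C3.
have [M M0 DM] := pinfty_ex_gt0 bD.
pose W := \sum_i `|w 0 i|.
have W0 : 0 <= W by apply: sumr_ge0.
have WM0 : 0 <= W * M / delta by rewrite divr_ge0 ?mulr_ge0 // ltW.
(* [W] dominates every [|w 0 i|], as fractional core variables require; [W * M / delta] handles
   repair directions; the 1 makes the threshold positive even when [w = 0]. *)
exists (W + 1 + W * M / delta); split; first by lra.
move=> gamma hgamma z zmin.
have gamma0 : 0 < gamma by lra.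
have zbin : binary_core (core w z).
  move=> [i wi]; rewrite ffunE /=.
  apply: (local_minimizer_core_binary gamma0 Qint bint zmin (C1 _ wi) wi).
  have : `|w 0 i| <= W by rewrite /W (bigD1 i) //= lerDl sumr_ge0.
  lra.
split=> //; apply: contrapT => nF; have [bz _] := zmin.
have [d [[Dd Td] dV]] := repair z bz (conj zbin nF).
(* Minimality makes the slope along [d] nonnegative, whereas it is at most
   [W * M - gamma * delta < 0]. *)
have [+ _] := local_minimizer_line zmin Td (penalized_line w b Q c gamma z d).
apply/negP; rewrite -ltNge; rewrite grad_quadratic in dV.
have wd : dot w d <= W * M.
  apply: ler_dot_norm1 => i; apply: le_trans (DM d Dd).
  (* The norm on row vectors is the maximum norm, so it bounds each coordinate of [d]. *)
  rewrite [leRHS]/Num.Def.normr /= mx_normrE.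
  by apply/bigmax_geP; right; exists (0, i).
have gd : W * M < gamma * delta by rewrite -ltr_pdivrMr //; lra.
have : gamma * dot (quadratic_grad Q b z) d <= gamma * - delta.
  by rewrite ler_pM2l.
lra.
Qed.
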